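(* There exists a generating set $\Sigma$ for the group $\mathbb{Z}_\omega=\bigoplus_{\aleph_0}\mathbb{Z}$ such that the Cayley graph $\mathrm{Cay}(\mathbb{Z}_\omega,\Sigma)$ of $\mathbb{Z}_\omega$ with respect to $\Sigma$, with its graph metric, contains isometric copies of $\mathsf{M}_n^{\ast}$ for arbitrarily large even $n$. In particular, the Cayley graph $\mathrm{Cay}(\mathbb{Z}_\omega,\Sigma)$ does not coarsely embed into any metric space of non zero generalized roundness.
   Context: The Cayley graph $\mathrm{Cay}(G,\Sigma)$ of an abelian group $G$ with respect to a generating set $\Sigma$ has vertex set $G$, with $g,h$ adjacent when $g\neq h$ and $g-h\in\Sigma\cup(-\Sigma)$; it is endowed with the usual graph (shortest path) metric. The generating set may be infinite. For a positive even integer $n$, $\mathsf{L}_n=\{k n^{-n}: k\in\mathbb{Z},\ 1\leq k\leq n^{2n}\}$ with the cyclic metric $\chi(x,y)=\min\{|x-y|,\,n^n-|x-y|\}$; $\mathsf{M}_n=\prod_{i=1}^{n^n}\mathsf{L}_n$ with the metric $d_\infty(x,y)=\max_i\chi(x_i,y_i)$; and $\mathsf{M}_n^{\ast}$ is the subspace of $\mathsf{M}_n$ consisting of the points all of whose coordinates are integers (so each coordinate lies in $\{1,\dots,n^n\}$). The generalized roundness $\mathfrak{q}(X)\in[0,\infty]$ of a metric space $(X,d)$ is the supremum of the set of all $p\geq 0$ such that for all integers $n\geq 2$ and all (not necessarily distinct) points $x_1,\dots,x_n,y_1,\dots,y_n\in X$, $$\sum_{1\leq i<j\leq n}\{d(x_i,x_j)^p+d(y_i,y_j)^p\}\leq\sum_{1\leq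 i,j\leq n}d(x_i,y_j)^p.$$ Non zero generalized roundness means $\mathfrak{q}>0$, including $\mathfrak{q}=\infty$. A map $f:(X,d)\to(Y,\varsigma)$ is a coarse embedding if there exist non-decreasing functions $\rho_1,\rho_2:[0,\infty)\to[0,\infty)$ with $\rho_1(d(x,y))\leq\varsigma(f(x),f(y))\leq\rho_2(d(x,y))$ for all $x,y\in X$ and $\lim_{t\to\infty}\rho_1(t)=\infty$. *)

(* Defs.v *)
From HB Require Import structures.
From mathcomp Require Import all_boot all_order all_algebra.
From mathcomp Require Import all_classical all_reals all_analysis.
From mathcomp.multinomials Require Import freeg.

Set Implicit Arguments.
Unset Strict Implicit.
Unset Printing Implicit Defensive.

Import Order.TTheory GRing.Theory Num.Theory.
Import numFieldNormedType.Exports.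

Local Open Scope classical_set_scope.
Local Open Scope ring_scope.

(* The direct sum of countably many copies of Z: integer-valued functions on
   nat of finite support, i.e. the free abelian group on nat. *)
Definition Zomega : zmodType := {freeg nat / int}.

Section Graphs.
Variables (T : choiceType) (e : rel T).

(* x and y are joined by a walk of k edges; [path e x p] does not list x in p,
   so its number of edges is [size p]. *)
Definition walk_of_length (x y : T) : pred nat :=
  fun k => `[< exists p : seq T, [/\ path e x p, last x p = y & size p = k] >].

(* Shortest walk length; the value 0 for vertices in different components is
   junk, and never occurs in a connected graph. *)
Definition graph_dist (x y : T) : nat :=
  match pselect (exists k, walk_of_length x y k) with
  | left w => ex_minn w
  | right _ => 0%N
  end.

End Graphs.

Section Cayley.
Variable G : zmodType.

Definition generates (S : set G) : Prop :=
  smallest [set H : set G | zmod_closed [in H]] S = setT.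

Definition cayley_adj (S : set G) : rel G :=
  fun g h => (g != h) && (g - h \in S `|` [set - s | s in S]).

Definition cayley_dist (R : realType) (S : set G) (g h : G) : R :=
  (graph_dist (cayley_adj S) g h)%:R.

End Cayley.

Section CyclicProducts.
Variables (R : realType) (n : nat).

Definition Lset : set R :=
  [set k%:~R / n%:R ^+ n | k in [set k : int | 1 <= k <= (n ^ (2 * n))%:Z]].

Definition chi (x y : R) : R := Num.min `|x - y| (n%:R ^+ n - `|x - y|).

Definition Mset : set {ffun 'I_(n ^ n) -> R} :=
  [set x | forall i, Lset (x i)].

(* chi is nonnegative on Lset, so starting the maximum at 0 is harmless. *)
Definition d_infty (x y : {ffun 'I_(n ^ n) -> R}) : R :=
  \big[Num.max/0]_(i < n ^ n) chi (x i) (y i).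

Definition Mstar : set {ffun 'I_(n ^ n) -> R} :=
  [set x | Mset x /\ forall i, x i \is a Num.int].

End CyclicProducts.

Definition contains_isometric_copy (R : realType) (X Y : Type)
    (A : set X) (dX : X -> X -> R) (dY : Y -> Y -> R) : Prop :=
  exists f : X -> Y, forall x y, A x -> A y -> dY (f x) (f y) = dX x y.

Section GeneralizedRoundness.
Variables (R : realType) (X : Type) (d : X -> X -> R).

Definition has_roundness (p : R) : Prop :=
  forall (n : nat) (x y : 'I_n -> X), (2 <= n)%N ->
    \sum_(i < n) \sum_(j < n | (i < j)%N)
        (d (x i) (x j) `^ p + d (y i) (y j) `^ p)
    <= \sum_(i < n) \sum_(j < n) d (x i) (y j) `^ p.

Definition generalized_roundness : \bar R :=
  ereal_sup [set p%:E | p in [set p : R | 0 <= p /\ has_roundness p]].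

End GeneralizedRoundness.

Section CoarseEmbeddings.
Variables (R : realType) (X Y : Type) (dX : X -> X -> R) (dY : Y -> Y -> R).

(* A function from [0, oo) to [0, oo) is represented by a function R -> R of
   which only the restriction to [0, oo) matters. *)
Definition nondecreasing_nonneg (rho : R -> R) : Prop :=
  (forall t, 0 <= t -> 0 <= rho t) /\
  (forall s t, 0 <= s -> s <= t -> rho s <= rho t).

Definition coarse_embedding (f : X -> Y) : Prop :=
  exists rho1 rho2 : R -> R,
    [/\ nondecreasing_nonneg rho1, nondecreasing_nonneg rho2,
        (forall x y, rho1 (dX x y) <= dY (f x) (f y) <= rho2 (dX x y))
      & rho1 t @[t --> +oo] --> +oo].

Definition coarsely_embeds : Prop := exists f : X -> Y, coarse_embedding f.

End CoarseEmbeddings.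

(* Main.v *)
(* A graph with vertex set V embeds isometrically into a Cayley graph of the free
   abelian group on V, with generators the differences of adjacent vertices: the
   function dist(y, _) is 1-Lipschitz, and its linear extension changes by at most
   1 along each edge of the Cayley graph.  Here V is the disjoint union of the
   tori (Z/n^n)^(n^n) with the sup metric of the cyclic distance; one base point
   per torus is added to the generators, and all tori embed simultaneously.

   For the obstruction (an Enflo type argument), suppose the target has roundness
   p > 0, and average d(F z, F(z + v))^p over all z in a torus and all permutations
   of the coordinates of v.  This average E(v) depends only on the values taken by
   v, counted with multiplicity; let E(r, h) be its value for v with h entries r,
   h entries -r and zeros elsewhere.  Applying the roundness inequality to a
   suitable family of N + N points gives (N - 1) E(2r, h) <= N E(r, N h).  Iterating
   K times with N >= 2K yields E(2^K, 1) <= 2 E(1, N^K), so the images of points at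
   distance 2^K do not move apart as K grows. *)
Require Import Defs.
From HB Require Import structures.
From mathcomp Require Import all_boot all_order all_algebra fingroup perm.
From mathcomp Require Import all_classical all_reals all_analysis.
From mathcomp Require Import zify ring lra.
From mathcomp.multinomials Require Import freeg.

Set Implicit Arguments.
Unset Strict Implicit.
Unset Printing Implicit Defensive.

Import Order.TTheory GRing.Theory Num.Theory.

Local Open Scope classical_set_scope.
Local Open Scope ring_scope.

(** * Cyclic sup norms *)

Section CyclicNorm.
Variable m : nat.
Implicit Types a b : 'Z_m.
Local Notation M := (Zp_trunc m).+2.

(** Distance to 0 along the cycle: the shorter of the two arcs, read off from the representatives of
    [a] and [- a] below the modulus [M]. *)
Definition cnorm a : nat := minn a (- a).

Lemma cnormE a : cnorm a = minn a (M - a).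
Proof.
rewrite /cnorm /=; case: (posnP a) => [->|a0]; first by rewrite !min0n.
by rewrite modn_small //; have := ltn_ord a; rewrite /= in a0 *; lia.
Qed.

Lemma cnorm0 : cnorm 0 = 0%N.
Proof. by rewrite cnormE /= min0n. Qed.

Lemma cnorm_eq0 a : cnorm a = 0%N -> a = 0.
Proof.
rewrite cnormE => h; apply: val_inj => /=.
by have := ltn_ord a; rewrite /= in h *; lia.
Qed.

Lemma cnormN a : cnorm (- a) = cnorm a.
Proof. by rewrite /cnorm opprK minnC. Qed.

Lemma Zp_valD a b :
  (a + b : 'Z_m) = (if a + b < M then a + b else a + b - M)%N :> nat.
Proof.
rewrite /=; case: ltnP => [/modn_small//|h].
rewrite -{1}(subnK h) modnDr modn_small //.
by have := ltn_ord a; have := ltn_ord b; rewrite /= in h *; lia.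
Qed.

Lemma cnormD a b : (cnorm (a + b)%R <= cnorm a + cnorm b)%N.
Proof.
rewrite !cnormE Zp_valD; have := ltn_ord a; have := ltn_ord b; rewrite /=.
by case: ifP; lia.
Qed.

(** For nonzero [a], go one unit along the shorter arc towards 0: [b] is 1 or -1 according to the
    half of the cycle containing [a]. *)
Lemma cnorm_step a k : (cnorm a <= k.+1)%N ->
  exists2 b, (cnorm b <= 1)%N & (cnorm (a - b)%R <= k)%N.
Proof.
have n1 : cnorm 1 = 1%N by rewrite cnormE /= modn_small //; lia.
have vN1 : (- 1 : 'Z_m) = (Zp_trunc m).+1 :> nat.
  by rewrite /= (modn_small (m := 1)) // subn1 modn_small.
have v1 : (1 : 'Z_m) = 1%N :> nat by rewrite /= modn_small.
have la : (a < M)%N := ltn_ord a.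
have [->|a0] := eqVneq a 0.
  by exists 0; rewrite ?subrr cnorm0.
have pa : (0 < a)%N by rewrite lt0n; apply: contra a0 => /eqP h; apply/eqP/val_inj.
rewrite cnormE => ak.
have [h|h] := leqP a (M - a).
  exists 1; rewrite ?n1 // cnormE Zp_valD vN1.
  by rewrite /= in h la ak pa *; case: ifP; lia.
exists (- 1); rewrite ?cnormN ?n1 // opprK cnormE Zp_valD v1.
by rewrite /= in h la ak pa *; case: ifP; lia.
Qed.

End CyclicNorm.

Section SupNorm.
Variables D m : nat.
Implicit Types v w : {ffun 'I_D -> 'Z_m}.

Definition snorm v : nat := \max_i cnorm (v i).

Lemma snorm_leP v k : reflect (forall i, cnorm (v i) <= k)%N (snorm v <= k)%N.
Proof.
apply: (iffP idP) => [/bigmax_leqP h i|h]; first exact: h.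
by apply/bigmax_leqP => i _; exact: h.
Qed.

Lemma snorm0 : snorm 0 = 0%N.
Proof. by apply/eqP; rewrite -leqn0; apply/snorm_leP => i; rewrite ffunE cnorm0. Qed.

Lemma snorm_eq0 v : (snorm v <= 0)%N -> v = 0.
Proof.
move/snorm_leP => h; apply/ffunP => i; rewrite ffunE; apply: cnorm_eq0.
by apply/eqP; rewrite -leqn0.
Qed.

Lemma snormN v : snorm (- v) = snorm v.
Proof. by apply: eq_bigr => i _; rewrite ffunE cnormN. Qed.

Lemma snormD v w : (snorm (v + w)%R <= snorm v + snorm w)%N.
Proof.
apply/snorm_leP => i; rewrite ffunE; apply: leq_trans (cnormD _ _) _.
by apply: leq_add; [move: i; apply/(snorm_leP v)|move: i; apply/(snorm_leP w)].
Qed.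

Lemma snorm_step v k : (snorm v <= k.+1)%N ->
  exists2 w, (snorm w <= 1)%N & (snorm (v - w)%R <= k)%N.
Proof.
move/snorm_leP => h.
have /choice[f fP] (i : 'I_D) : exists b, (cnorm b <= 1)%N && (cnorm (v i - b)%R <= k)%N.
  by have [b b1 bk] := cnorm_step (h i); exists b; rewrite b1.
exists [ffun i => f i]; apply/snorm_leP => i; rewrite !ffunE;
  by have /andP[] := fP i.
Qed.

End SupNorm.

(** * The Cayley graph containing the tori *)

Local Notation block n := {ffun 'I_(n ^ n) -> 'Z_(n ^ n)}.

Definition vertex : countType := {n : nat & block n}.

Definition delta (n : nat) (w : block n) : Zomega :=
  << pickle (Tagged (fun n => block n) w : vertex) >>.

(* [pickle] need not be onto: the last family adds the basis vectors that encode no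
   vertex. *)
Definition torus_gens : set Zomega := [set g | [\/
   exists n (v w : block n), (snorm (v - w)%R <= 1)%N /\ g = delta v - delta w,
   exists n, g = delta (0 : block n) |
   exists2 i, pickle_inv i = None :> option vertex & g = << i >>]].

(** Each vertex of a torus is joined to the base point by steps of sup norm at most 1, each of which
    is a generator; the remaining basis vectors are generators themselves. *)
Lemma torus_gens_generates : generates torus_gens.
Proof.
apply/seteqP; split=> // g _ H [[H0 HB] subH].
have {}H0 : H 0 by move: H0; rewrite inE.
have {}HB x y : H x -> H y -> H (x - y).
  by move=> hx hy; have := HB x y; rewrite !inE; apply.
have HN x : H x -> H (- x) by move=> hx; rewrite -[- x]add0r; exact: HB.
have HD x y : H x -> H y -> H (x + y).
  by move=> hx hy; rewrite -[y]opprK; apply: HB => //; exact: HN.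
have Hdelta n (w : block n) : H (delta w).
  move: {2}(snorm w) (leqnn (snorm w)) => k; elim: k w => [|k IHk] w.
    by move/snorm_eq0 ->; apply: subH; apply: Or32; exists n.
  move=> /snorm_step[u u1 wu].
  rewrite -[delta w](subrK (delta (w - u))); apply: HD; last exact: IHk.
  apply: subH; apply: Or31; exists n, w, (w - u); split=> //.
  by rewrite opprB addrC subrK.
have Hi (i : nat) : H (<< i >> : Zomega).
  case E: (pickle_inv i : option vertex) => [[n w]|]; last first.
    by apply: subH; apply: Or33; exists i.
  by have := pickle_invK (T := vertex) i; rewrite E /= => <-; exact: Hdelta.
have HM (x : Zomega) (k : int) : H x -> H (x *~ k).
  move=> hx; have Hn (l : nat) : H (x *+ l).
    by elim: l => [|l IHl]; rewrite ?mulr0n ?mulrS //; exact: HD.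
  by case: k => l; [exact: Hn|rewrite NegzE mulrNz; apply: HN; exact: Hn].
elim/(@freeg_ind_dom0 int nat): g => // k x D _ _ HD0; apply: HD => //.
by rewrite -[k]intz -freegU_mulz; apply: HM.
Qed.

(** * Linear functionals bounding Cayley distances from below *)

Section Functional.
Variables (n : nat) (y : block n).

(* Normalised to vanish at the base point [0] of the block of [y], which is itself
   a generator. *)
Definition height (i : nat) : int :=
  if pickle_inv i is Some u
  then let: w := tagged_as (Tagged (fun n => block n) y) u in
       if tag (u : vertex) == n then (snorm (y - w))%:Z - (snorm y)%:Z else 0
  else 0.

Definition lin_height : Zomega -> int := @fglift int int^o nat height.

Lemma lin_heightB g h : lin_height (g - h) = lin_height g - lin_height h.
Proof. exact: (@lift_is_additive int nat int^o height). Qed.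

Lemma lin_height_delta (w : block n) :
  lin_height (delta w) = (snorm (y - w))%:Z - (snorm y)%:Z.
Proof.
rewrite /lin_height /delta liftU scale1r /height pickleK_inv /=.
by rewrite eqxx tagged_asE.
Qed.

Lemma lin_height_delta_neq k (w : block k) : k != n -> lin_height (delta w) = 0.
Proof.
move=> kn; rewrite /lin_height /delta liftU scale1r /height pickleK_inv /=.
by rewrite (negbTE kn).
Qed.

(** For an edge inside the torus of [y] this is the triangle inequality; base points and everything
    outside that torus have height 0. *)
Lemma lin_height_gens g : torus_gens g -> `|lin_height g| <= 1.
Proof.
case=> [[k [v [w [vw ->]]]]|[k ->]|[i iN ->]].
- rewrite lin_heightB; have [kn|kn] := eqVneq k n; last first.
    by rewrite !lin_height_delta_neq.
  subst k; rewrite !lin_height_delta.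
  have := snormD (y - v) (v - w); have := snormD (y - w) (w - v).
  rewrite (addrA (y - w)) (addrA (y - v)) !subrK -[w - v]opprB snormN.
  move: (snorm (v - w)) vw (snorm (y - v)) (snorm (y - w)) (snorm y) => a a1 b c d.
  by lia.
- have [kn|kn] := eqVneq k n; last by rewrite lin_height_delta_neq.
  by subst k; rewrite lin_height_delta subr0 subrr.
- by rewrite /lin_height liftU scale1r /height iN.
Qed.

Lemma lin_height_adj g h : cayley_adj torus_gens g h ->
  `|lin_height g - lin_height h| <= 1.
Proof.
case/andP => _; rewrite inE -lin_heightB => -[|[k kS kE]].
  exact: lin_height_gens.
have -> : g - h = 0 - k by rewrite -kE sub0r.
rewrite lin_heightB; have -> : lin_height 0 = 0.
  by rewrite -(subrr 0) lin_heightB subrr.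
by rewrite sub0r normrN; exact: lin_height_gens.
Qed.

Lemma lin_height_path g p : path (cayley_adj torus_gens) g p ->
  `|lin_height g - lin_height (last g p)| <= (size p)%:Z.
Proof.
elim: p g => [|h p IHp] g /=; first by rewrite subrr.
case/andP=> /lin_height_adj gh /IHp hp.
apply: le_trans (ler_distD (lin_height h) _ _) _.
by rewrite -add1n PoszD lerD.
Qed.

End Functional.

Lemma delta_path n k (v w : block n) : (snorm (v - w)%R <= k)%N ->
  exists p, [/\ path (cayley_adj torus_gens) (delta v) p,
    last (delta v) p = delta w & (size p <= k)%N].
Proof.
elim: k v => [|k IHk] v.
  by move=> /snorm_eq0/eqP; rewrite subr_eq0 => /eqP ->; exists [::].
move=> /snorm_step[u u1 vwu].
have [|p [pP pl ps]] := IHk (v - u); first by rewrite addrAC.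
(* Adjacency excludes loops, so a step that does not move is dropped; this is why only [size p <= k]
   is claimed. *)
have [vu|vu] := eqVneq (delta v) (delta (v - u)).
  by exists p; rewrite vu; split=> //; exact: leqW.
exists (delta (v - u) :: p); split=> //=; rewrite pP andbT /cayley_adj vu /=.
rewrite inE; left; apply: Or31; exists n, v, (v - u); split=> //.
by rewrite opprB addrC subrK.
Qed.

Lemma cayley_dist_delta (R : realType) n (v w : block n) :
  cayley_dist R torus_gens (delta v) (delta w) = (snorm (v - w))%:R.
Proof.
rewrite /cayley_dist; congr (_%:R); rewrite /graph_dist.
have lower p : path (cayley_adj torus_gens) (delta v) p ->
    last (delta v) p = delta w -> (snorm (v - w)%R <= size p)%N.
  (* The height centred at [v] is [- snorm v] at [delta v] and [snorm (v - w) - snorm v] at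
     [delta w], and changes by at most 1 per edge. *)
  move=> pP pl; have := lin_height_path v pP; rewrite pl !lin_height_delta subrr snorm0.
  by move: (snorm v) (snorm _) (size p) => a b c; lia.
have [p [pP pl ps]] := delta_path (leqnn (snorm (v - w)%R)).
have pw : walk_of_length (cayley_adj torus_gens) (delta v) (delta w) (size p).
  by apply/asboolP; exists p.
case: pselect => [ex|[]]; last by exists (size p).
case: ex_minnP => k /asboolP[q [qP ql <-]] /(_ _ pw) qp.
by apply/eqP; rewrite eqn_leq (leq_trans qp ps) lower.
Qed.

(** * Isometric copies of the integer tori *)

Lemma Mstar_coord (R : realType) n (x : {ffun 'I_(n ^ n) -> R}) i :
  (0 < n)%N -> Mstar x -> exists2 k : nat, (0 < k <= n ^ n)%N & x i = k%:R.
Proof.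
move=> n0 [/(_ i)[k /andP[k1 k2] kx] /(_ i) xint].
have nn0 : 0 < n%:R ^+ n :> R by rewrite exprn_gt0 // ltr0n.
have x0 : 0 < x i.
  by rewrite -kx divr_gt0 // ltr0z (lt_le_trans _ k1).
move: xint; rewrite intrEge0 ?ltW // => /natrP[l xl].
exists l => //; rewrite xl ltr0n in x0; rewrite x0 /=.
rewrite -(ler_nat R) -xl -kx ler_pdivrMr // natrX -exprD -natrX.
by rewrite addnn -mul2n -[_%:R]/((_ : nat)%:~R) ler_int.
Qed.

Lemma chi_natr (R : realType) n k l : (1 < n)%N ->
  (0 < k <= n ^ n)%N -> (0 < l <= n ^ n)%N ->
  chi n k%:R l%:R = (cnorm (k%:R - l%:R : 'Z_(n ^ n)))%:R :> R.
Proof.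
move=> n1; wlog lk : k l / (l <= k)%N => [hw|].
  have [|/ltnW kl] := leqP l k; first exact: hw.
  by move=> hk hl; rewrite /chi distrC -cnormN opprB; apply: hw.
move=> /andP[k0 kn] /andP[l0 ln].
have nn1 : (1 < n ^ n)%N.
  by rewrite (leq_trans n1) // -{1}(expn1 n) leq_exp2l // ltnW.
(* The bound [l >= 1] keeps [k - l] below the modulus even for [k = n ^ n], the representative of
   the residue 0. *)
have kl : (k - l < n ^ n)%N by lia.
rewrite -natrB // cnormE val_Zp_nat // Zp_cast // modn_small //.
rewrite /chi -natrB // normr_nat -natrX -natrB; last exact: ltnW.
by rewrite -natr_min -minEnat.
Qed.

Lemma Mstar_isometric (R : realType) (n : nat) : (1 < n)%N ->
  contains_isometric_copy (@Mstar R n) (@d_infty R n)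
    (cayley_dist R torus_gens).
Proof.
move=> n1; exists (fun x => delta ([ffun i => (Num.truncn (x i))%:R] : block n)).
move=> x y xM yM; rewrite cayley_dist_delta /d_infty /snorm.
have natr_maxn : {morph (fun k : nat => k%:R : R) : k l / maxn k l >-> Num.max k l}.
  by move=> k l; rewrite -maxEnat natr_max.
rewrite (big_morph _ natr_maxn (id1 := 0)) //.
apply: eq_bigr => i _; rewrite !ffunE.
have [k kn ->] := Mstar_coord i (ltnW n1) xM.
have [l ln ->] := Mstar_coord i (ltnW n1) yM.
by rewrite !natrK chi_natr.
Qed.

(** * Averaged roundness inequalities *)

Lemma eq_fibers_perm (T : eqType) D (f g : 'I_D -> T) :
  (forall t, \sum_k (f k == t) = \sum_k (g k == t))%N ->
  exists s : 'S_D, forall k, f k = g (s k).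
Proof.
move=> fg; have : perm_eq [tuple f k | k < D] [tuple g k | k < D].
  have countE (u : 'I_D -> T) t :
      count_mem t [tuple u k | k < D] = (\sum_k (u k == t))%N.
    rewrite /= count_map -sum1_count big_mkcond big_enum /=.
    by apply: eq_bigr => k _; case: eqP.
  by apply/allP => t _ /=; rewrite !countE fg.
move=> /tuple_permP[s fgs]; exists s => k.
have /(congr1 (fun u => tnth u k)) := val_inj fgs.
by rewrite !tnth_mktuple.
Qed.

Lemma sum_ltn_const (R : zmodType) N (c : R) :
  \sum_(i < N) \sum_(j < N | (i < j)%N) (c + c) = c *+ (N * N) - c *+ N.
Proof.
pose S := \sum_(i < N) \sum_(j < N | (i < j)%N) c.
have S' : S = \sum_(i < N) \sum_(j < N | (j < i)%N) c.
  by rewrite /S (exchange_big_dep xpredT).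
have : \sum_(i < N) \sum_(j < N) c = S + S + c *+ N.
  have -> : c *+ N = \sum_(i < N) c by rewrite sumr_const card_ord.
  rewrite {2}S' /S.
  rewrite -!big_split; apply: eq_bigr => i _.
  rewrite /= (bigID (fun j : 'I_N => (i < j)%N)) /= -addrA; congr (_ + _).
  rewrite (bigD1 i) ?ltnn //= addrC; congr (_ + _); apply: eq_bigl => j.
  by rewrite -leqNgt ltn_neqAle andbC -val_eqE.
under eq_bigr do rewrite sumr_const card_ord.
rewrite sumr_const card_ord -mulrnA => ->; rewrite addrK -big_split.
by apply: eq_bigr => i _; rewrite big_split.
Qed.

(** Bernoulli's inequality [(1 - 1/N)^K >= 1 - K/N] with denominators cleared. *)
Lemma bernoulli_nat N K : (K <= N)%N -> (N ^ K * (N - K) <= N * N.-1 ^ K)%N.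
Proof.
elim: K => [|K IHK] KN; first by rewrite !expn0 subn0 mul1n muln1.
have := IHK (ltnW KN); rewrite !expnS.
have : (N * (N - K.+1) <= N.-1 * (N - K))%N by nia.
move: (N ^ K)%N (N.-1 ^ K)%N => a b h1 h2.
apply: (@leq_trans (a * (N.-1 * (N - K)))); first by nia.
by nia.
Qed.

(** Since [N - K] is at least [N / 2], Bernoulli bounds by 2 the product of the [K] factors
    [N / (N - 1)] lost in the iteration. *)
Lemma expn_le_double N K : (2 * K <= N)%N -> (0 < N)%N ->
  (N ^ K <= 2 * N.-1 ^ K)%N.
Proof.
move=> KN N0; have := @bernoulli_nat N K.
move: (N ^ K)%N (N.-1 ^ K)%N => a b; nia.
Qed.

Lemma sum_divn (g : nat -> nat) h L : (0 < h)%N ->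
  (\sum_(k < L * h) g (k %/ h) = h * \sum_(q < L) g q)%N.
Proof.
move=> h0; elim: L => [|L IHL]; first by rewrite !big_ord0 muln0.
rewrite mulSn addnC big_split_ord /= IHL big_ord_recr /= mulnDr; congr addn.
under eq_bigr => k _ do rewrite divnMDl // divn_small ?ltn_ord // addn0.
by rewrite sum_nat_const card_ord.
Qed.

(** * Displacements with prescribed value counts *)

Section Balanced.
Variables D m : nat.
Implicit Types (v w : {ffun 'I_D -> 'Z_m}) (r : 'Z_m).

(* [v] has [h] entries [r], [h] entries [- r] and zeros elsewhere.  Counting fibres
   keeps this correct when [r], [- r] and [0] are not distinct. *)
Definition balanced h r v := forall t,
  (\sum_k (v k == t) =
   h * ((r == t) + (- r == t)) + (D - 2 * h) * (0%R == t))%N.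

Lemma balanced_coord h r v k : balanced h r v ->
  [\/ v k = r, v k = - r | v k = 0].
Proof.
move=> /(_ (v k)); rewrite (bigD1 k) //= eqxx.
have [<- _|_] := eqVneq r (v k); first by apply: Or31.
have [<- _|_] := eqVneq (- r) (v k); first by apply: Or32.
have [<- _|_] := eqVneq 0 (v k); first by apply: Or33.
by rewrite !muln0.
Qed.

Lemma balanced_attains h r v : (0 < h)%N -> balanced h r v -> exists k, v k = r.
Proof.
move=> h0 /(_ r) e.
have [k /eqP|nr] := pickP (fun k => v k == r); first by exists k.
by move: e; rewrite big1 => [|k _]; rewrite ?nr // eqxx; nia.
Qed.

(** Repeating each value of [f] on a run of [h] coordinates multiplies its count by [h]; coordinates
    past the first [L] runs only add zeros. *)
Lemma balanced_spread h L r (f : nat -> 'Z_m) : (0 < h)%N ->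
  (L * h <= D)%N -> (forall q, (L <= q)%N -> f q = 0) ->
  forall N, (2 * N <= L)%N ->
  (forall t, (\sum_(q < L) (f q == t) =
     N * ((r == t) + (- r == t)) + (L - 2 * N) * (0%R == t))%N) ->
  balanced (N * h) r [ffun k : 'I_D => f (k %/ h)%N].
Proof.
move=> h0 LD f0 N NL fE t.
under eq_bigr do rewrite ffunE.
rewrite -(big_mkord xpredT (fun k => (f (k %/ h)%N == t) : nat)).
rewrite (big_cat_nat _ (n := (L * h)%N)) //=.
rewrite big_mkord (sum_divn (fun q => f q == t)) // fE.
rewrite big_nat_cond (eq_bigr (fun => (0%R == t) : nat)); last first.
  by move=> k /andP[/andP[Lk _] _]; rewrite f0 // leq_divRL.
rewrite -big_nat_cond sum_nat_const_nat.
have -> : (D - 2 * (N * h) = h * (L - 2 * N) + (D - L * h))%N by nia.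
by rewrite mulnDl mulnDr !mulnA [(h * N)%N]mulnC -addnA.
Qed.

End Balanced.

Lemma exchange_big_pairs (R : nmodType) (I J S Z : finType) (P : I -> pred J)
    (G : I -> J -> S -> Z -> R) :
  \sum_i \sum_(j | P i j) \sum_s \sum_z G i j s z =
  \sum_s \sum_z \sum_i \sum_(j | P i j) G i j s z.
Proof.
under eq_bigr do rewrite exchange_big.
rewrite exchange_big; apply: eq_bigr => s _ /=.
under eq_bigr do rewrite exchange_big.
by rewrite exchange_big.
Qed.

Lemma mulrn_sqrB_le (R : realFieldType) N (x y : R) : (0 < N)%N ->
  x *+ (N * N) - x *+ N <= y *+ N *+ N -> N.-1%:R * x <= N%:R * y.
Proof.
move=> N0; have NR : 0 < N%:R :> R by rewrite ltr0n.
rewrite -[y *+ N *+ N]mulrnA -[x *+ (N * N)]mulr_natr -[x *+ N]mulr_natr.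
rewrite -[y *+ (N * N)]mulr_natr natrM -subn1 natrB // => xy.
by rewrite -(ler_pM2l NR); lra.
Qed.

(** * Energies and their doubling inequality *)

Section Energy.
Variables (R : realType) (Y : Type) (d : Y -> Y -> R) (p : R).
Variables (D m : nat) (F : {ffun 'I_D -> 'Z_m} -> Y).
Local Notation V := {ffun 'I_D -> 'Z_m}.
Implicit Types (v w : V) (r : 'Z_m) (s : 'S_D).

Definition perm_coord s v : V := [ffun k => v (s k)].

Definition energy v : R :=
  \sum_s \sum_(z : V) d (F z) (F (z + perm_coord s v)) `^ p.

Lemma energy_perm s v : energy (perm_coord s v) = energy v.
Proof.
rewrite /energy [RHS](reindex_inj (mulIg s)) /=; apply: eq_bigr => t _.
apply: eq_bigr => z _; congr (d _ (F (z + _)) `^ _).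
by apply/ffunP => k; rewrite !ffunE permM.
Qed.

Lemma energy_balanced h r v w :
  balanced h r v -> balanced h r w -> energy v = energy w.
Proof.
move=> vb wb; have [s sE] : exists s : 'S_D, forall k, v k = w (s k).
  by apply: eq_fibers_perm => t; rewrite vb wb.
have -> : v = perm_coord s w by apply/ffunP => k; rewrite ffunE.
exact: energy_perm.
Qed.

Lemma energyB v w : energy (w - v) =
  \sum_s \sum_(z : V) d (F (z + perm_coord s v)) (F (z + perm_coord s w)) `^ p.
Proof.
apply: eq_bigr => s _.
have shift_inj : injective (fun z : V => z + perm_coord s v) by exact: addIr.
rewrite (reindex_inj shift_inj) /=.
apply: eq_bigr => z _; congr (d _ (F _) `^ _).
by apply/ffunP => k; rewrite !ffunE; ring.
Qed.

(** For each permutation [s] and translation [z], roundness is applied to the images of the points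
    [z + perm_coord s (a i)] and [z + perm_coord s (b j)]; the inequalities are then summed. *)
Lemma energy_roundness N (a b : 'I_N -> V) : has_roundness d p -> (2 <= N)%N ->
  \sum_(i < N) \sum_(j < N | (i < j)%N) (energy (a j - a i) + energy (b j - b i))
  <= \sum_(i < N) \sum_(j < N) energy (b j - a i).
Proof.
move=> dp N2; pose X s (z : V) (u : 'I_N -> V) i := F (z + perm_coord s (u i)).
have -> : \sum_(i < N) \sum_(j < N | (i < j)%N)
      (energy (a j - a i) + energy (b j - b i)) =
    \sum_s \sum_(z : V) \sum_(i < N) \sum_(j < N | (i < j)%N)
      (d (X s z a i) (X s z a j) `^ p + d (X s z b i) (X s z b j) `^ p).
  rewrite -[RHS]exchange_big_pairs; apply: eq_bigr => i _; apply: eq_bigr => j _.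
  rewrite !energyB -big_split; apply: eq_bigr => s _; by rewrite -big_split.
have -> : \sum_(i < N) \sum_(j < N) energy (b j - a i) =
    \sum_s \sum_(z : V) \sum_(i < N) \sum_(j < N) d (X s z a i) (X s z b j) `^ p.
  rewrite -[RHS]exchange_big_pairs; apply: eq_bigr => i _; apply: eq_bigr => j _.
  exact: energyB.
by apply: ler_sum => s _; apply: ler_sum => z _; exact: dp.
Qed.

(* The points are [a i] = [r] on the first [N] runs of [h] coordinates, with the sign
   flipped on run [i], and [b j] the same on the next [N] runs: [b j - a i] has
   [N * h] entries of each sign, while [a j - a i] and [b j - b i] vanish outside two
   runs, where they are [2 r] and [- 2 r]. *)
Lemma energy_step h r v w N : has_roundness d p -> (2 <= N)%N ->
  (0 < h)%N -> (2 * N * h <= D)%N ->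
  balanced (N * h) r v -> balanced h (r *+ 2) w ->
  N.-1%:R * energy w <= N%:R * energy v.
Proof.
move=> dp N2 h0 hD vb wb.
pose fa i q : 'Z_m := if (q < N)%N then (if q == i then - r else r) else 0.
pose fb j q : 'Z_m :=
  if (N <= q < N + N)%N then (if q == N + j then - r else r)%N else 0.
pose spread (f : nat -> 'Z_m) : V := [ffun k : 'I_D => f (k %/ h)%N].
have Ew (f g : nat -> 'Z_m) (i j : nat) : (i < N + N)%N -> (j < N + N)%N ->
    i != j ->
    (forall q, g q - f q = if q == i then r *+ 2 else if q == j then - r *+ 2 else 0) ->
    energy (spread g - spread f) = energy w.
  move=> iN jN ij fg; apply: energy_balanced wb.
  have -> : spread g - spread f = [ffun k : 'I_D => (fun q => g q - f q) (k %/ h)%N].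
    by apply/ffunP => k; rewrite !ffunE.
  rewrite -[X in balanced X]mul1n.
  apply: (@balanced_spread D m h (N + N) _ (fun q => g q - f q)) => //.
  - by rewrite addnn -mul2n.
  - by move=> q Nq; rewrite fg !gtn_eqF // (leq_trans _ Nq).
  - by lia.
  move=> t; rewrite (bigD1 (Ordinal iN)) // (bigD1 (Ordinal jN)) /=; last first.
    by rewrite -val_eqE eq_sym.
  rewrite !fg !eqxx (eq_sym j) (negbTE ij) mulNrn mul1n addnA; congr addn.
  transitivity (\sum_(q < N + N | (q != Ordinal iN) && (q != Ordinal jN)) (0%R == t))%N.
    apply: eq_bigr => q; rewrite -!val_eqE => /andP[qi qj].
    by rewrite fg (negbTE qi) (negbTE qj).
  rewrite sum_nat_const; congr muln.
  rewrite -(@eq_card _ (predC (pred2 (Ordinal iN) (Ordinal jN)))); last first.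
    by move=> q; rewrite !inE negb_or.
  have := cardC (pred2 (Ordinal iN) (Ordinal jN)).
  by rewrite card2 card_ord -val_eqE /= ij => /(congr1 (subn^~ 2)); rewrite addKn.
(* On the first [N] runs the difference is [r] on run [i] and [- r] elsewhere; on the next [N] runs
   it is [- r] on run [N + j] and [r] elsewhere. Each sign fills [1 + (N - 1) = N] runs. *)
have Ev (i j : nat) : (i < N)%N -> (j < N)%N ->
    energy (spread (fb j) - spread (fa i)) = energy v.
  move=> iN jN; apply: energy_balanced vb.
  have -> : spread (fb j) - spread (fa i) =
      [ffun k : 'I_D => (fun q => fb j q - fa i q) (k %/ h)%N].
    by apply/ffunP => k; rewrite !ffunE.
  apply: (@balanced_spread D m h (N + N) _ (fun q => fb j q - fa i q)) => //.
  - by rewrite addnn -mul2n.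
  - move=> q Nq; rewrite /fa /fb (leq_gtF Nq) andbF.
    by rewrite leq_gtF ?subrr // (leq_trans _ Nq) ?leq_addr.
  - by rewrite mul2n addnn.
  have oneN (l : nat) x y (t : 'Z_m) : (l < N)%N ->
      (\sum_(q < N) ((if q == l :> nat then x else y) == t) =
       (x == t) + N.-1 * (y == t))%N.
    move=> lN; rewrite (bigD1 (Ordinal lN)) //= eqxx; congr addn.
    rewrite (eq_bigr (fun=> (y == t) : nat)); last first.
      by move=> q ql; rewrite -val_eqE /= in ql; rewrite (negbTE ql).
    rewrite sum_nat_const; congr muln.
    by have := cardC1 (Ordinal lN); rewrite card_ord.
  move=> t; rewrite big_split_ord.
  rewrite (eq_bigr (fun q : 'I_N =>
    ((if q == i :> nat then r else - r) == t) : nat)); last first.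
    move=> q _; rewrite /fa /fb [val _]/(q : nat) ltn_ord leqNgt ltn_ord sub0r.
    by case: ifP; rewrite ?opprK.
  rewrite oneN //.
  rewrite (eq_bigr (fun q : 'I_N =>
    ((if q == j :> nat then - r else r) == t) : nat)); last first.
    move=> q _; rewrite /fa /fb [val _]/(N + q)%N.
    rewrite leq_addr ltn_add2l ltn_ord eqn_add2l ltnNge leq_addr.
    by rewrite subr0.
  rewrite oneN //.
  rewrite mul2n addnn subnn mul0n addn0.
  rewrite -[N in RHS](prednK (ltnW N2)).
  move: (nat_of_bool (r == t)) (nat_of_bool (- r == t)) => x y.
  by rewrite -[LHS]/(_ + _)%N; ring.
have := @energy_roundness N (fun i => spread (fa i)) (fun j => spread (fb j)) dp N2.
(* For [i < j] the difference of the [a] points lives on runs [i] and [j], that of the [b] points on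
   runs [N + i] and [N + j]; [Ew] covers both. *)
under eq_bigr => i _.
  under eq_bigr => j ij.
    rewrite (Ew _ _ i j) ?ltn_addr ?neq_ltn ?ij //; last first.
      have := ltn_ord i; have := ltn_ord j; rewrite /fa => jN iN q.
      have [->|qi] := eqVneq q (i : nat).
        by rewrite iN ltn_eqF // opprK mulr2n.
      have [->|qj] := eqVneq q (j : nat); first by rewrite jN mulr2n.
      by case: ifP; rewrite subrr.
    rewrite (Ew _ _ (N + i)%N (N + j)%N) ?ltn_add2l ?eqn_add2l ?neq_ltn ?ij //;
      last first.
      have := ltn_ord i; have := ltn_ord j; rewrite /fb => jN iN q.
      have [->|qi] := eqVneq q (N + i)%N.
        by rewrite leq_addr ltn_add2l iN eqn_add2l ltn_eqF // opprK mulr2n.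
      have [->|qj] := eqVneq q (N + j)%N.
        by rewrite leq_addr ltn_add2l jN mulr2n.
      by case: ifP; rewrite subrr.
    over.
  over.
under [X in _ <= X -> _]eq_bigr => i _.
  under eq_bigr => j _ do rewrite Ev //.
  rewrite sumr_const card_ord; over.
rewrite sumr_const card_ord sum_ltn_const.
exact: mulrn_sqrB_le (ltnW N2).
Qed.

Lemma balanced_inhabited h r : (0 < h)%N -> (2 * h <= D)%N ->
  exists v : V, balanced h r v.
Proof.
move=> h0 hD.
pose f q : 'Z_m := if q == 0%N then r else if q == 1%N then - r else 0.
exists [ffun k : 'I_D => f (k %/ h)%N]; rewrite -[X in balanced X]mul1n.
apply: (@balanced_spread D m h 2 r f) => // [[|[|q]] //|t].
by rewrite 2!big_ord_recl big_ord0 addn0 mul1n muln1 subnn mul0n addn0.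
Qed.

(** Each round doubles the entry, divides the multiplicity by [N] and costs a factor [N / (N - 1)],
    leading from [(r, N^K)] to [(2^K r, 1)]. *)
Lemma energy_iter K N r v w : has_roundness d p -> (2 <= N)%N ->
  (2 * N ^ K <= D)%N -> balanced (N ^ K) r v -> balanced 1 (r *+ 2 ^ K) w ->
  (N.-1 ^ K)%:R * energy w <= (N ^ K)%:R * energy v.
Proof.
move=> dp N2; elim: K r v => [|K IHK] r v ND vb wb.
  by rewrite !mul1r (energy_balanced vb wb).
have N0 : (0 < N ^ K)%N by rewrite expn_gt0 ltnW.
have ND' : (2 * N * N ^ K <= D)%N by rewrite -mulnA -expnS.
have [u ub] : exists u : V, balanced (N ^ K) (r *+ 2) u.
  by apply: balanced_inhabited => //; apply: leq_trans ND'; nia.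
have wu : (N.-1 ^ K)%:R * energy w <= (N ^ K)%:R * energy u.
  apply: (IHK (r *+ 2)) => //; last by rewrite -mulrnA -expnS.
  by apply: leq_trans ND'; nia.
have uv : N.-1%:R * energy u <= N%:R * energy v.
  by apply: (energy_step dp N2 N0 ND') => //; rewrite -expnS.
rewrite !expnS !natrM -mulrA.
apply: le_trans (ler_wpM2l _ wu) _; first exact: ler0n.
by rewrite mulrCA [leRHS]mulrAC [leRHS]mulrC ler_wpM2l ?ler0n.
Qed.

(** Compares the energy of a displacement of norm at most 1 with that of one of norm at least [2^K];
    the constant [(N / (N - 1))^K] from [energy_iter] is at most 2. *)
Lemma roundness_scale_bound K N (c C : R) : has_roundness d p -> 0 < p ->
  (2 <= N)%N -> (2 * K <= N)%N -> (2 * N ^ K <= D)%N -> (2 * 2 ^ K < m)%N ->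
  0 <= c -> (forall y y', 0 <= d y y') ->
  (forall z v, (snorm v <= 1)%N -> d (F z) (F (z + v)) <= C) ->
  (forall z v, (2 ^ K <= snorm v)%N -> c <= d (F z) (F (z + v))) ->
  c `^ p <= 2 * C `^ p.
Proof.
move=> dp p0 N2 KN ND Km c0 d0 dC cd.
have C0 : 0 <= C by apply: le_trans (d0 _ _) (dC 0 0 _); rewrite snorm0.
have N0 : (0 < N ^ K)%N by rewrite expn_gt0 ltnW.
have [v vb] := balanced_inhabited 1 N0 ND.
have [w wb] : exists w : V, balanced 1 ((1 : 'Z_m) *+ 2 ^ K) w.
  by apply: balanced_inhabited => //; apply: leq_trans ND; rewrite leq_mul2l.
have m1 : (1 < m)%N by have := expn_gt0 2 K; lia.
(* As [2 * 2 ^ K < m], the residue [2 ^ K] stays in the first half of the cycle. *)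
have cnormX : cnorm ((1 : 'Z_m) *+ 2 ^ K) = (2 ^ K)%N.
  by rewrite cnormE val_Zp_nat // Zp_cast // modn_small; [apply/minn_idPl|]; lia.
have cnorm1 : (cnorm (1%R : 'Z_m) <= 1)%N.
  by rewrite cnormE -[1]/(1%:R) val_Zp_nat // modn_small // geq_minl.
(* [T] counts the pairs of a permutation and a translation, turning pointwise bounds into bounds on
   [energy]. *)
pose T : R := \sum_(s : 'S_D) \sum_(z : V) 1.
have T0 : 0 < T.
  rewrite /T; under eq_bigr do rewrite sumr_const.
  rewrite sumr_const -mulrnA ltr0n muln_gt0; apply/andP; split; apply/card_gt0P.
    by exists (0 : V).
  by exists 1%g.
have vC : energy v <= T * C `^ p.
  rewrite /T mulr_suml; apply: ler_sum => s _; rewrite mulr_suml; apply: ler_sum => z _.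
  rewrite mul1r; apply: ge0_ler_powR; rewrite ?nnegrE ?(ltW p0) //.
  apply: dC; apply/snorm_leP => k; rewrite ffunE.
  by case: (balanced_coord (s k) vb) => ->; rewrite ?cnormN // cnorm0.
have cw : T * c `^ p <= energy w.
  rewrite /T mulr_suml; apply: ler_sum => s _; rewrite mulr_suml; apply: ler_sum => z _.
  rewrite mul1r; apply: ge0_ler_powR; rewrite ?nnegrE ?(ltW p0) //.
  apply: cd; have [k wk] := balanced_attains (isT : (0 < 1)%N) wb.
  rewrite -cnormX -wk -(permKV s k).
  by apply: leq_trans (leq_bigmax ((s^-1)%g k)); rewrite ffunE.
have := energy_iter dp N2 ND vb wb.
have NK : (N ^ K)%:R <= 2 * (N.-1 ^ K)%:R :> R.
  by rewrite -natrM ler_nat expn_le_double // ltnW.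
have NK0 : 0 < (N.-1 ^ K)%:R :> R by rewrite ltr0n expn_gt0 -ltnS prednK ?N2 // ltnW.
move=> wv; rewrite -(ler_pM2l NK0) -(ler_pM2l T0).
have h1 : (N.-1 ^ K)%:R * (T * c `^ p) <= (N.-1 ^ K)%:R * energy w by rewrite ler_pM2l.
have h2 : (N ^ K)%:R * energy v <= (N ^ K)%:R * (T * C `^ p) by rewrite ler_wpM2l.
have h3 : (N ^ K)%:R * (T * C `^ p) <= 2 * (N.-1 ^ K)%:R * (T * C `^ p).
  by rewrite ler_wpM2r // mulr_ge0 ?powR_ge0 // ltW.
by lra.
Qed.

End Energy.

(** * Contradiction with coarse embeddability *)

Lemma has_roundness0 (R : realType) (Y : Type) (d : Y -> Y -> R) :
  has_roundness d 0.
Proof.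
move=> n x y _.
(* All powers equal 1, so the two sides are [n * n - n] and [n * n]. *)
under eq_bigr do under eq_bigr do rewrite !powRr0.
rewrite sum_ltn_const.
under [leRHS]eq_bigr do under eq_bigr do rewrite powRr0.
under [leRHS]eq_bigr do rewrite sumr_const card_ord.
by rewrite sumr_const card_ord -mulrnA gerBl.
Qed.

(** Exponent 0 is always admissible, so without a positive one the set of exponents is exactly [{0}]
    and its supremum is 0. *)
Lemma generalized_roundness_pos (R : realType) (Y : Type) (d : Y -> Y -> R) :
  generalized_roundness d <> 0%E -> exists2 p, 0 < p & has_roundness d p.
Proof.
move=> q0; apply: contrapT => np; apply: q0.
rewrite /generalized_roundness.
have -> : [set p%:E | p in [set p : R | 0 <= p /\ has_roundness d p]] = [set 0%E].
  apply/seteqP; split=> [_ [p [p0 pd] <-]|_ ->] /=; last first.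
    by exists 0 => //; split=> //; exact: has_roundness0.
  move: p0; rewrite le_eqVlt => /orP[/eqP <- //|p0].
  by case: np; exists p.
exact: ereal_sup1.
Qed.

Lemma torus_scale_bound (R : realType) (Y : metricType R) (p : R)
    (f : Zomega -> Y) (rho1 rho2 : R -> R) :
  has_roundness (fun x y : Y => mdist x y) p -> 0 < p ->
  nondecreasing_nonneg rho1 -> nondecreasing_nonneg rho2 ->
  (forall x y, rho1 (cayley_dist R torus_gens x y) <= mdist (f x) (f y)
    <= rho2 (cayley_dist R torus_gens x y)) ->
  forall K, rho1 (2 ^+ K) `^ p <= 2 * rho2 1 `^ p.
Proof.
move=> dp p0 [rho1_ge0 rho1_le] [_ rho2_le] frho K.
(* [N] dominates both 2 and [2 * K]; [n] makes [n ^ n] large enough both as dimension, at least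
   [2 * N ^ K], and as modulus, above [2 * 2 ^ K]. *)
pose N := (2 * K).+2; pose n := (2 * N ^ K + 2 * 2 ^ K).+1.
have n1 : (1 < n)%N by have := expn_gt0 2 K; rewrite /n; lia.
have nn : (n <= n ^ n)%N by rewrite -{1}(expn1 n) leq_exp2l // ltnW.
have distE (z v : block n) :
    cayley_dist R torus_gens (delta z) (delta (z + v)) = (snorm v)%:R.
  by rewrite cayley_dist_delta opprD addrA subrr sub0r snormN.
apply: (@roundness_scale_bound R Y (fun x y => mdist x y) p (n ^ n) (n ^ n)
  (fun w => f (delta w)) K N) => //.
- by rewrite /N; lia.
- by apply: leq_trans nn; rewrite /n; lia.
- by apply: leq_trans nn; rewrite /n ltnS leq_addl.
- by apply: rho1_ge0; rewrite exprn_ge0.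
- by move=> *; exact: mdist_ge0.
- move=> z v v1; have /andP[_] := frho (delta z) (delta (z + v)).
  by rewrite distE => /le_trans; apply; apply: rho2_le; rewrite ?ler_nat ?ler1n // lern1.
- move=> z v v1; have /andP[+ _] := frho (delta z) (delta (z + v)).
  rewrite distE; apply: le_trans; apply: rho1_le; rewrite ?exprn_ge0 //.
  by rewrite -natrX ler_nat.
Qed.

Theorem theorem3p4 (R : realType) :
  exists Sigma : set Zomega,
    [/\ generates Sigma,
        (forall N : nat, exists n : nat,
           [/\ (N <= n)%N, (0 < n)%N, ~~ odd n
             & contains_isometric_copy (@Mstar R n) (@d_infty R n)
                 (@cayley_dist Zomega R Sigma)])
      & forall Y : metricType R,
          generalized_roundness (fun x y : Y => mdist x y) <> 0%E ->
          ~ coarsely_embeds (@cayley_dist Zomega R Sigma)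
              (fun x y : Y => mdist x y)].
Proof.
exists torus_gens; split; first exact: torus_gens_generates.
  move=> N; exists N.+1.*2; split; rewrite ?odd_double //.
    by rewrite -addnn; lia.
  by apply: Mstar_isometric; rewrite -addnn; lia.
move=> Y /generalized_roundness_pos[p p0 dp] [f [rho1 [rho2 [r1 r2 frho rho1oo]]]].
have bound := torus_scale_bound dp p0 r1 r2 frho.
(* Chosen so that the [p]-th power of [M] is one more than the bound, which does not depend on
   [K]. *)
pose M : R := (2 * rho2 1 `^ p + 1) `^ p^-1.
have B0 : 0 <= 2 * rho2 1 `^ p by rewrite mulr_ge0 ?powR_ge0.
have [t [_ tM]] := (@cvgryPge _ _ _ _ rho1).1 rho1oo M.
pose K := Num.bound `|t|.
have tK : t < 2 ^+ K :> R.
  apply: le_lt_trans (ler_norm t) _; apply: lt_trans (archi_boundP (normr_ge0 t)) _.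
  by rewrite -natrX ltr_nat ltn_expl.
have := bound K; apply/negP; rewrite -ltNge.
apply: (@lt_le_trans _ _ (M `^ p)).
  by rewrite /M -powRrM mulVf ?gt_eqF // powRr1 ?ltrDl // addr_ge0.
apply: ge0_ler_powR; first exact: ltW.
- by rewrite nnegrE powR_ge0.
- by rewrite nnegrE; apply: r1.1; rewrite exprn_ge0.
- exact: tM.
Qed.
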